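(* Let $n,k,d$ be integers with $1\le k\le d<n$, let $\alpha>0$, and for each integer $M\ge0$ put $n_M=n+M$, $k_M=k+M$, $d_M=d+M$, $\gamma_{MSR}=\frac{d_M\alpha}{d_M-k_M+1}$ and $\gamma_{MBR}=\alpha$. Let $s\in[0,1]$ be fixed. Then $$\lim_{M\to\infty}\frac{C^{\mathrm{exact}}_{n_M,k_M,d_M}\big(\alpha,\,s\gamma_{MSR}+(1-s)\gamma_{MBR}\big)}{C_{k_M,d_M}\big(\alpha,\,s\gamma_{MSR}+(1-s)\gamma_{MBR}\big)}=1.$$
   Context: A distributed storage system (DSS) with parameters $(n,k,d)$ stores a file across $n$ nodes, each storing an amount $\alpha$ of information (e.g. $\alpha$ symbols over a finite field, where symbols may be split into arbitrarily many sub-symbols), such that the file can be reconstructed from the contents of any $k$ nodes, and any lost node can be repaired by contacting any $d$ of the remaining nodes, each of which transmits an amount $\beta$ to the replacement node, for a total repair bandwidth $\gamma=d\beta$. Repair is exact: the replacement node stores exactly the same content as the lost node. $C^{\mathrm{exact}}_{n,k,d}(\alpha,\gamma)$ denotes the maximum size of a file that can be stored by such an exact-repair DSS with $n$ nodes, node size $\alpha$ and total repair bandwidth $\gamma$. Also $C_{k,d}(\alpha,\gamma)=\sum_{j=0}^{k-1}\min\{\alpha,\frac{d-j}{d}\gamma\}$ (the functional-repair capacity). *)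

(* Defs.v *)
From HB Require Import structures.
From mathcomp Require Import all_boot all_order all_algebra.
From mathcomp Require Import all_classical all_reals all_analysis.
Set Implicit Arguments. Unset Strict Implicit. Unset Printing Implicit Defensive.
Import Order.TTheory GRing.Theory Num.Theory.
Local Open Scope classical_set_scope.
Local Open Scope ring_scope.

(* An exact-repair (n,k,d) code (possibly nonlinear):
   - F       : the finite set of files,
   - 'I_A    : the node alphabet, W i f = content of node i for file f,
   - 'I_Bt   : the alphabet of a single repair message (per helper).
   Data collection: any k nodes determine the file.
   Exact repair: for every failed node i and every set H of d other nodes,
   each helper j in H sends a message S j (W j f) depending only on its own
   content, and the content of node i is a function of these d messages. *)
Definition exact_repair_code (n k d : nat) (F : finType) (A Bt : nat)
    (W : 'I_n -> F -> 'I_A) : Prop :=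
  (forall K : {set 'I_n}, #|K| = k ->
     exists Dec : seq 'I_A -> F,
       forall f : F, Dec [seq W j f | j <- enum K] = f) /\
  (forall (i : 'I_n) (H : {set 'I_n}), i \notin H -> #|H| = d ->
     exists (S : 'I_n -> 'I_A -> 'I_Bt) (Rec : seq 'I_Bt -> 'I_A),
       forall f : F, Rec [seq S j (W j f) | j <- enum H] = W i f).

(* Exact-repair capacity C^exact_{n,k,d}(alpha, gamma): supremum of the
   normalized file size ln|F| / t over all exact-repair codes and all units
   t > 0 (t nats = one "symbol"; allowing arbitrary t and alphabets realizes
   arbitrary sub-symbolization) such that node storage ln A <= alpha t and
   per-helper repair traffic ln Bt <= (gamma/d) t, i.e. beta = gamma/d. *)
Definition Cexact {R : realType} (n k d : nat) (alpha gamma : R) : R :=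
  sup [set B : R | exists (F : finType) (A Bt : nat) (W : 'I_n -> F -> 'I_A)
                          (t : R),
         [/\ 0 < t, @exact_repair_code n k d F A Bt W,
             ln (A%:R : R) <= alpha * t,
             ln (Bt%:R : R) <= gamma / d%:R * t &
             B = ln (#|F|%:R : R) / t]].

Definition Cfr {R : realType} (k d : nat) (alpha gamma : R) : R :=
  \sum_(j < k) Num.min alpha ((d - j)%:R / d%:R * gamma).

(* Main.v *)
Require Import Defs.
From HB Require Import structures.
From mathcomp Require Import all_boot all_order all_algebra.
From mathcomp Require Import all_classical all_reals all_analysis.
From mathcomp Require Import zify ring.
Set Implicit Arguments. Unset Strict Implicit. Unset Printing Implicit Defensive.
Import Order.TTheory GRing.Theory Num.Theory.
Import numFieldNormedType.Exports.
Local Open Scope classical_set_scope.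
Local Open Scope ring_scope.

(** The capacity is bounded above by the cut-set bound [Cfr], by counting: the
    contents of nodes [0, ..., j] take at most [min(A, Bt^(d - j))] times as many
    values as those of nodes [0, ..., j - 1].  For [s = 0] the product-matrix MBR
    code meets this bound.  For [s > 0] take [c >= (d - k + 1) / s], which does
    not depend on [M]: an exact MSR code with parameters [(n_M, k_M - c, d_M)]
    has per-helper bandwidth [alpha / (d - k + 1 + c)], which the budget allows,
    and stores [(k_M - c) alpha].  As [Cfr <= k_M alpha], the ratio lies between
    [1 - c / k_M] and [1]. *)

(** * Counting images and fibers of finite maps *)

Section Counting.
Local Open Scope set_scope.
Local Open Scope nat_scope.

(** Turns a separation property into a decoding function; [f0] supplies its value outside the image
    of [p]. *)
Lemma factor_through (F T U : Type) (f0 : F) (p : F -> T) (q : F -> U) :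
  (forall f f', p f = p f' -> q f = q f') -> exists phi, forall f, phi (p f) = q f.
Proof.
move=> pq.
have tot y : exists u, forall f, p f = y -> q f = u.
  have [[f <-]|no] := pselect (exists f, p f = y); first by exists (q f) => f' /pq.
  by exists (q f0) => f pf; case: no; exists f.
have [phi phiP] := boolp.choice tot.
by exists phi => f; rewrite (phiP (p f) f).
Qed.

Lemma leq_card_imset_factor (F T U : finType) (p : F -> T) (q : F -> U) :
  (forall f f', p f = p f' -> q f = q f') -> #|q @: [set: F]| <= #|p @: [set: F]|.
Proof.
move=> pq; have [F0|/card_gt0P[f0 _]] := posnP #|F|.
  have -> : q @: [set: F] = finset.set0; last by rewrite cards0.
  by apply/setP => u; rewrite inE; apply/imsetP => -[f _ _]; have := card0_eq F0 f.
have [phi phiE] := factor_through f0 pq.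
have -> : q @: [set: F] = phi @: (p @: [set: F]).
  by rewrite -imset_comp; apply: eq_imset => f /=; rewrite phiE.
exact: leq_imset_card.
Qed.

Lemma leq_card_imset_pair (F T U V : finType) (p : F -> T) (h : F -> U)
    (q : F -> V) :
  (forall f f', p f = p f' -> h f = h f' -> q f = q f') ->
  #|q @: [set: F]| <= #|p @: [set: F]| * #|U|.
Proof.
move=> pq; rewrite -cardsT -cardsX.
apply: (@leq_trans #|(fun f => (p f, h f)) @: [set: F]|).
  by apply: leq_card_imset_factor => f f' [/pq]; apply.
apply/subset_leq_card/fintype.subsetP => _ /imsetP[f _ ->].
by rewrite !inE /= imset_f ?inE.
Qed.

Lemma exists_large_fiber (T U : finType) (g : T -> U) : 0 < #|T| ->
  exists y, #|T| <= #|U| * #|[set x | g x == y]|.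
Proof.
case/card_gt0P => x0 _.
pose y := [arg max_(y > g x0) #|[set x | g x == y]|].
exists y.
rewrite -[X in X <= _]cardsT -sum1_card (partition_big g predT) //=.
rewrite -sum_nat_const; apply: leq_sum => z _.
rewrite sum1_card /y; case: arg_maxnP => // w _ /(_ z isT).
rewrite !cardsE; apply: leq_trans.
by apply/subset_leq_card/fintype.subsetP => x /andP[].
Qed.

Lemma card_ord_lt (n m : nat) : m <= n -> #|[set j : 'I_n | j < m]| = m.
Proof.
move=> le_mn; have widen_inj : injective (widen_ord le_mn).
  by move=> i j /(congr1 val) ij; apply: val_inj.
rewrite -[RHS]card_ord -(card_imset _ widen_inj).
apply: eq_card => j; rewrite inE; apply/idP/imsetP => [lt_jm|[i _ ->]]; last exact: (ltn_ord i).
by exists (Ordinal lt_jm) => //; apply: val_inj.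
Qed.

End Counting.

(** * The cut-set bound *)

Section CutSet.
Local Open Scope set_scope.
Local Open Scope nat_scope.

(* Nodes [0, ..., k-1] determine the file.  Given nodes [0, ..., j-1], node [j]
   is determined either by its own content, or by the messages of the [d - j]
   nodes [j+1, ..., d] in a repair with helpers [{0, ..., d} \ {j}]. *)
Lemma exact_repair_code_card (n k d : nat) (F : finType) (A Bt : nat)
    (W : 'I_n -> F -> 'I_A) :
  k <= d -> d < n -> exact_repair_code k d Bt W ->
  #|F| <= \prod_(j < k) minn A (Bt ^ (d - j)).
Proof.
move=> le_kd lt_dn [HK HR].
(* Masking with [None] gives all the [g m] one codomain, so the induction on [m] adds a single
   coordinate at a time. *)
pose g m f := [ffun j : 'I_n => if j < m then Some (W j f) else None].
have gP m f f' (j : 'I_n) : j < m -> g m f = g m f' -> W j f = W j f'.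
  by move=> lt_jm /ffunP/(_ j); rewrite !ffunE lt_jm => -[].
have stepW m (U : finType) (h : F -> U) (lt_mn : m < n) :
    (forall f f', g m f = g m f' -> h f = h f' ->
       W (Ordinal lt_mn) f = W (Ordinal lt_mn) f') ->
    #|g m.+1 @: [set: F]| <= #|g m @: [set: F]| * #|U|.
  move=> hP; apply: (leq_card_imset_pair (h := h)) => f f' gE hE.
  apply/ffunP => j; rewrite !ffunE ltnS leq_eqVlt.
  have [jm|_] /= := eqVneq (j : nat) m; last by move/ffunP/(_ j): gE; rewrite !ffunE.
  congr Some; have -> : j = Ordinal lt_mn by apply: val_inj.
  exact: hP.
have cardg m : m <= k -> #|g m @: [set: F]| <= \prod_(j < m) minn A (Bt ^ (d - j)).
  elim: m => [_|m IHm lt_mk].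
    rewrite big_ord0 -(@cards1 _ ([ffun=> None] : {ffun 'I_n -> option 'I_A})).
    apply/subset_leq_card/fintype.subsetP => _ /imsetP[f _ ->]; rewrite inE.
    by apply/eqP/ffunP => j; rewrite !ffunE.
  have lt_mn : m < n by lia.
  apply: (@leq_trans (#|g m @: [set: F]| * minn A (Bt ^ (d - m)))); last first.
    by rewrite big_ord_recr /= leq_mul2r IHm ?orbT // ltnW.
  rewrite minnMr leq_min; apply/andP; split.
    rewrite -[X in _ * X]card_ord.
    exact: (stepW _ _ (W (Ordinal lt_mn)) lt_mn).
  pose H := [set j : 'I_n | j < d.+1] :\ Ordinal lt_mn.
  have [||S [Rec RecE]] := HR (Ordinal lt_mn) H.
  - by rewrite !inE eqxx.
  - have := cardsD1 (Ordinal lt_mn) [set j : 'I_n | j < d.+1].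
    rewrite card_ord_lt // inE /= -/H.
    have -> : m < d.+1 by lia.
    by rewrite add1n => -[].
  have lt_late (x : 'I_(d - m)) : m.+1 + x < n by have := ltn_ord x; lia.
  pose late x := Ordinal (lt_late x).
  rewrite -[X in X ^ _]card_ord -[X in _ ^ X]card_ord -card_ffun.
  apply: (stepW _ _ (fun f => [ffun x => S (late x) (W (late x) f)]) lt_mn).
  move=> f f' gE hE; rewrite -!RecE; congr Rec.
  apply/eq_in_map => j; rewrite mem_enum !inE -val_eqE /= => /andP[j_m le_jd].
  have [lt_jm|le_mj] := ltnP j m; first by rewrite (gP _ _ _ _ lt_jm gE).
  have lt_x : j - m.+1 < d - m by lia.
  move/ffunP/(_ (Ordinal lt_x)): hE; rewrite !ffunE.
  have -> // : late (Ordinal lt_x) = j by apply: val_inj => /=; lia.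
have [|Dec DecE] := HK [set j : 'I_n | j < k]; first by rewrite card_ord_lt //; lia.
rewrite -[X in X <= _]cardsT -(@card_imset _ _ (g k)) ?cardg // => f f' gE.
rewrite -(DecE f) -(DecE f'); congr Dec.
by apply/eq_in_map => j; rewrite mem_enum inE => lt_jk; apply: gP gE.
Qed.

End CutSet.

(** Decoders need not be exhibited: it suffices that the available data separate files, or contents
    of the lost node, and [factor_through] does the rest. *)
Lemma exact_repair_code_of_inj (n k d : nat) (F T U : finType) (f0 : F)
    (W : 'I_n -> F -> T) :
  (forall (K : {set 'I_n}) f f', #|K| = k ->
     (forall j, j \in K -> W j f = W j f') -> f = f') ->
  (forall (i : 'I_n) (H : {set 'I_n}), i \notin H -> #|H| = d ->
     exists S : 'I_n -> T -> U, forall f f',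
       (forall j, j \in H -> S j (W j f) = S j (W j f')) -> W i f = W i f') ->
  exact_repair_code k d #|U| (fun i f => enum_rank (W i f)).
Proof.
move=> HK HR; split=> [K cardK|i H iH cardH].
  have sep f f' : [seq enum_rank (W j f) | j <- enum K] =
                  [seq enum_rank (W j f') | j <- enum K] -> f = f'.
    move/eq_in_map => E; apply: (HK K) => // j jK.
    by apply: enum_rank_inj; apply: E; rewrite mem_enum.
  have [Dec DecE] := factor_through f0 sep.
  by exists Dec.
have [S SP] := HR i H iH cardH.
have sep f f' : [seq enum_rank (S j (W j f)) | j <- enum H] =
                [seq enum_rank (S j (W j f')) | j <- enum H] ->
                enum_rank (W i f) = enum_rank (W i f').
  move/eq_in_map => E; congr enum_rank; apply: SP => j jH.
  by apply: enum_rank_inj; apply: E; rewrite mem_enum.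
have [Rec RecE] := factor_through f0 sep.
exists (fun j a => enum_rank (S j (enum_val a))), Rec => f.
rewrite -[RHS]RecE; congr Rec; apply: eq_map => j.
by rewrite enum_rankK.
Qed.

(** * Vandermonde systems *)

Section Vandermonde.
Context {F : fieldType} {I : finType} {x : I -> F}.

(** [v] lists the coefficients of a polynomial of degree below [#|A|] with [#|A|] distinct roots. *)
Lemma vandermonde_coef_eq0 (m : nat) (A : {set I}) (v : 'I_m -> F) :
  {in A &, injective x} -> (forall a : 'I_m, (#|A| <= a)%N -> v a = 0) ->
  (forall i, i \in A -> \sum_(a < m) v a * x i ^+ a = 0) -> forall a, v a = 0.
Proof.
move=> x_inj v0 vA a.
pose P := \poly_(b < m) oapp v 0 (insub b).
suff P0 : P = 0.
  have := congr1 (fun Q : {poly F} => Q`_a) P0.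
  by rewrite coef_poly ltn_ord valK coef0.
apply: (roots_geq_poly_eq0 (rs := [seq x i | i <- enum A])).
- apply/allP => _ /mapP[i iA ->]; rewrite mem_enum in iA.
  rewrite rootE horner_poly -[X in _ == X](vA i iA); apply/eqP.
  by apply: eq_bigr => b _; rewrite valK.
- rewrite map_inj_in_uniq ?enum_uniq // => i j.
  by rewrite !mem_enum; apply: x_inj.
- rewrite size_map -cardE; apply/leq_sizeP => b le_Ab; rewrite coef_poly.
  by case: ltnP => // lt_bm; rewrite insubT /= v0.
Qed.

(* Test the relations against the polynomial that vanishes on all points
   [x j], [j \in A], except [x i]. *)
Lemma vandermonde_weight_eq0 (r : nat) (A : {set I}) (c : I -> F) :
  {in A &, injective x} -> (#|A| <= r)%N -> (forall i, i \notin A -> c i = 0) ->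
  (forall t : 'I_r, \sum_i x i ^+ t * c i = 0) -> forall i, c i = 0.
Proof.
move=> x_inj le_Ar cA cr i; have [iA|/cA//] := boolP (i \in A).
pose P := \prod_(a <- [seq x j | j <- enum (A :\ i)%SET]) ('X - a%:P).
have sizeP : (size P <= r)%N.
  rewrite size_prod_XsubC size_map -cardE; apply: leq_trans le_Ar.
  by rewrite [#|A|](cardsD1 i) iA.
have rootP j : root P (x j) = (x j \in [seq x j | j <- enum (A :\ i)%SET]).
  exact: root_prod_XsubC.
have : \sum_j P.[x j] * c j = 0.
  under eq_bigr do rewrite (horner_coef_wide _ sizeP) mulr_suml.
  rewrite exchange_big big1 //= => t _.
  under eq_bigr do rewrite -mulrA.
  by rewrite -mulr_sumr cr mulr0.
rewrite (bigD1 i) //= big1 ?addr0 => [/eqP|j ji].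
  rewrite mulf_eq0 => /orP[|/eqP//]; rewrite -[_ == 0]/(root P (x i)) rootP.
  case/mapP => j; rewrite mem_enum !inE => /andP[ji jA] xij.
  by rewrite (x_inj _ _ iA jA xij) eqxx in ji.
have [jA|/cA->] := boolP (j \in A); last by rewrite mulr0.
have : root P (x j) by rewrite rootP map_f // mem_enum !inE ji.
by move/eqP ->; rewrite mul0r.
Qed.

End Vandermonde.

(** * Constructions of MBR and MSR codes *)

Lemma prime_field_inj (I : finType) :
  exists2 p, prime p & exists x : I -> 'F_p, injective x.
Proof.
have [p ltIp p_pr] := prime_above #|I|; exists p => //.
exists (fun i => (enum_rank i)%:R) => i j /(congr1 val).
rewrite /= !val_Fp_nat // !modn_small => [/val_inj/enum_rank_inj//||];
  exact: ltn_trans (ltn_ord _) ltIp.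
Qed.

(* The message matrix is a symmetric [d x d] matrix whose lower right
   [(d - k) x (d - k)] block vanishes, and node [i] stores its product with
   [(1, x_i, x_i^2, ...)]. *)
Lemma mbr_code (n k d : nat) : (k <= d)%N ->
  exists (q : nat) (F : finType) (A Bt : nat) (W : 'I_n -> F -> 'I_A),
    [/\ (1 < q)%N, A = (q ^ d)%N, Bt = q,
        #|F| = (q ^ \sum_(j < k) (d - j))%N & exact_repair_code k d Bt W].
Proof.
move=> le_kd; have [p p_pr [x x_inj]] := prime_field_inj 'I_n.
(* The free entries of the message matrix: its upper triangle outside the zero block. [M] gets the
   others by symmetry or as the default 0. *)
pose Idx := {u : 'I_d * 'I_d | (u.1 <= u.2)%N && (u.1 < k)%N}.
pose F := {ffun Idx -> 'F_p}.
pose M (f : F) (a b : 'I_d) : 'F_p := oapp f 0 (insub (if (a <= b)%N then (a, b) else (b, a))).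
have M_sym f a b : M f a b = M f b a.
  rewrite /M; congr (oapp _ _ (insub _)).
  by case: ltngtP => // /val_inj ->.
have M_big f (a b : 'I_d) : (k <= a)%N -> (k <= b)%N -> M f a b = 0.
  move=> ka kb; rewrite /M insubF //.
  by case: ifP => _ /=; apply: negbTE; rewrite negb_and -!leqNgt ?ka ?kb orbT.
pose T := {ffun 'I_d -> 'F_p}.
pose W (i : 'I_n) (f : F) : T := [ffun b => \sum_a M f a b * x i ^+ a].
have WB i f f' : W i f = W i f' <-> forall b, \sum_a (M f a b - M f' a b) * x i ^+ a = 0.
  split=> [/ffunP E b|E].
    have := E b; rewrite !ffunE => /eqP; rewrite -subr_eq0 -sumrB => /eqP Eb.
    by rewrite -[RHS]Eb; apply: eq_bigr => a _; rewrite mulrBl.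
  apply/ffunP => b; rewrite !ffunE; apply/eqP; rewrite -subr_eq0 -sumrB; apply/eqP.
  by rewrite -[RHS](E b); apply: eq_bigr => a _; rewrite mulrBl.
exists p, F, #|T|, #|{: 'F_p}|, (fun i f => enum_rank (W i f)); split.
- exact: prime_gt1.
- by rewrite card_ffun card_Fp // card_ord.
- exact: card_Fp.
- rewrite card_ffun card_Fp // card_sig -sum1_card; congr (_ ^ _)%N.
  rewrite (big_ord_widen _ _ le_kd) /=.
  rewrite (eq_bigl (fun u : 'I_d * 'I_d => (u.1 < k)%N && (u.1 <= u.2)%N)); last first.
    by move=> u; rewrite inE andbC.
  rewrite -(pair_big_dep (fun a : 'I_d => (a < k)%N) (fun a b : 'I_d => (a <= b)%N)
    (fun _ _ => 1%N)) /=.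
  apply: eq_bigr => a _; rewrite sum1_card.
  have := cardsC [set j : 'I_d | (j < a)%N]%SET.
  rewrite card_ord_lt 1?ltnW // card_ord => /(congr1 (subn^~ a)).
  rewrite addKn => <-; apply: eq_card => b.
  by rewrite !inE -leqNgt.
apply: (@exact_repair_code_of_inj n k d F T 'F_p 0 W) => [K f f' cardK E|i H iH cardH].
  pose D a b := M f a b - M f' a b.
  have WD j b : j \in K -> \sum_a D a b * x j ^+ a = 0.
    by move=> jK; move: b; apply/WB; apply: E.
  (* This applies first to columns from [k] on, by the zero block; by symmetry the rows from [k] on
     then vanish, so it applies to every column. *)
  have D_col (b : 'I_d) : (forall a : 'I_d, (k <= a)%N -> D a b = 0) -> forall a, D a b = 0.
    move=> Db; apply: (vandermonde_coef_eq0 (x := x) (A := K)).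
    - by move=> j j' _ _; apply: x_inj.
    - by rewrite cardK.
    - by move=> j; apply: WD.
  have D0 a b : D a b = 0.
    apply: (D_col) => a' ka'; rewrite /D M_sym [M f' _ _]M_sym -/(D b a').
    by apply: D_col => b' kb'; rewrite /D !M_big ?subrr.
  apply/ffunP => u; have /andP[le_u lt_u] := valP u.
  have := D0 (val u).1 (val u).2; rewrite /D /M le_u -surjective_pairing valK /=.
  by move/eqP; rewrite subr_eq0 => /eqP.
(* By symmetry of [M], the message of helper [j] is the value at [x j] of a polynomial whose
   coefficients are the content of node [i]; [d] values fix it. *)
exists (fun _ (c : T) => \sum_(b < d) c b * x i ^+ b) => f f' E.
apply/WB => b.
suff Db a : \sum_b (M f a b - M f' a b) * x i ^+ b = 0.
  by rewrite -[RHS](Db b); apply: eq_bigr => a _; rewrite M_sym [M f' _ _]M_sym.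
move: a; apply: (vandermonde_coef_eq0 (x := x) (A := H)) => [j j' _ _|a|j jH].
- exact: x_inj.
- by rewrite cardH leqNgt ltn_ord.
have := E j jH; move/eqP; rewrite -subr_eq0 -sumrB => /eqP Ej.
under eq_bigr do rewrite mulr_suml.
rewrite exchange_big -[RHS]Ej; apply: eq_bigr => b' _ /=.
rewrite !ffunE -mulrBl -sumrB mulr_suml; apply: eq_bigr => a _.
by rewrite -mulrBl mulrAC.
Qed.

(* The Ye--Barg code: the contents [c_i : [s]^n -> 'F_p], [s = d - k + 1], satisfy
   [sum_i lam (i, a_i) ^ t * c_i a = 0] for [t < n - k] and all [a].  To repair
   node [i], helper [j] sums [c_j] over the coordinate [a_i].  Summing the checks
   over [a_i] leaves a relation between the [s] wanted values of [c_i] and one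
   message per other node; once the [d] received messages are known,
   [s + (n - 1 - d) = n - k] unknowns remain, as many as there are checks. *)
Lemma msr_code (n k d : nat) : (k <= d)%N -> (d < n)%N ->
  exists (q : nat) (F : finType) (A Bt : nat) (W : 'I_n -> F -> 'I_A),
    [/\ (1 < q)%N, A = (q ^ ((d - k).+1 ^ n))%N, Bt = (q ^ ((d - k).+1 ^ n.-1))%N,
        (q ^ (k * (d - k).+1 ^ n) <= #|F|)%N &
        forall k', (k <= k')%N -> exact_repair_code k' d Bt W].
Proof.
move=> le_kd lt_dn; set s := (d - k).+1.
have [p p_pr [lam lam_inj]] := prime_field_inj ('I_n * 'I_s)%type.
pose I := {ffun 'I_n -> 'I_s}; pose T := {ffun I -> 'F_p}.
pose X := {ffun 'I_n -> T}; pose r := (n - k)%N.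
pose syn (x : X) : {ffun 'I_r * I -> 'F_p} :=
  [ffun ta : 'I_r * I => \sum_i lam (i, ta.2 i) ^+ ta.1 * x i ta.2].
have X_gt0 : (0 < #|{: X}|)%N by apply/card_gt0P; exists [ffun=> [ffun=> 0]].
(* Taking a large fiber of [syn] instead of its kernel avoids computing a rank; differences of files
   still satisfy the homogeneous checks. *)
have [y] := exists_large_fiber syn X_gt0.
pose F := {x : X | syn x == y}; rewrite cardsE -(card_sig (fun x => syn x == y)) -/F.
rewrite !card_ffun card_prod card_Fp // !(card_ffun, card_ord) => cardF.
have p_gt1 := prime_gt1 p_pr; have p_gt0 := prime_gt0 p_pr.
have {}cardF : (p ^ (k * s ^ n) <= #|{: F}|)%N.
  move: cardF; rewrite -expnM.
  have -> : (s ^ n * n = (r * s ^ n) + k * s ^ n)%N.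
    by rewrite -mulnDl mulnC; congr (_ * _)%N; rewrite /r; lia.
  by rewrite expnD leq_pmul2l // expn_gt0 p_gt0.
have /card_gt0P[f0 _] : (0 < #|{: F}|)%N by apply: leq_trans cardF; rewrite expn_gt0 p_gt0.
pose U := {ffun {ffun 'I_n.-1 -> 'I_s} -> 'F_p}.
pose W (i : 'I_n) (f : F) : T := val f i.
have check f f' (a : I) (t : 'I_r) : \sum_i lam (i, a i) ^+ t * (W i f a - W i f' a) = 0.
  have /eqP/ffunP/(_ (t, a)) := valP f; rewrite ffunE /= => Ef.
  have /eqP/ffunP/(_ (t, a)) := valP f'; rewrite ffunE /= -Ef => /eqP.
  rewrite eq_sym -subr_eq0 -sumrB => /eqP Eff; rewrite -[RHS]Eff.
  by apply: eq_bigr => i _; rewrite mulrBr.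
exists p, F, #|T|, #|U|, (fun i f => enum_rank (W i f)); split=> //.
- by rewrite card_ffun card_Fp // !(card_ffun, card_ord).
- by rewrite card_ffun card_Fp // !(card_ffun, card_ord).
move=> k' le_kk'; apply: (@exact_repair_code_of_inj n k' d F T U f0 W) =>
  [K f f' cardK E|i H iH cardH].
  (* For fixed [a], two files that agree on [K] differ in at most [n - k] nodes, and there are
     [n - k] checks at [a]. *)
  apply/val_inj/ffunP => i; apply/ffunP => a; apply/eqP; rewrite -subr_eq0; apply/eqP.
  move: i; apply: (vandermonde_weight_eq0 (x := fun i => lam (i, a i)) (r := r) (A := (~: K)%SET)).
  - by move=> i j _ _ /lam_inj[].
  - by have := cardsC K; rewrite cardK card_ord /r; move: #|(~: K)%SET| => m; lia.
  - by move=> i; rewrite inE negbK => iK; rewrite -/(W i f) (E i iK) subrr.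
  - exact: check.
pose ins (b : {ffun 'I_n.-1 -> 'I_s}) (u : 'I_s) : I := [ffun j => oapp b u (unlift i j)].
have insi b u : ins b u i = u by rewrite ffunE unlift_none.
have insj b u j : j != i -> ins b u j = ins b ord0 j.
  by rewrite eq_sym => ij; rewrite !ffunE; have [j' _ ->] := unlift_some ij.
have insK (a : I) : a = ins [ffun j => a (lift i j)] (a i).
  by apply/ffunP => j; rewrite ffunE; case: unliftP => [j'|] -> //=; rewrite ffunE.
exists (fun _ (c : T) => [ffun b => \sum_u c (ins b u)]) => f f' E.
pose z j (a : I) := W j f a - W j f' a.
suff z0 b u : z i (ins b u) = 0.
  by apply/ffunP => a; apply/eqP; rewrite -subr_eq0 (insK a) -/(z _ _) z0.
(* The unknowns, placed at the points [lam (j, u)]: node [i] occupies all its [s] points, any other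
   node only the one with [u = ins b ord0 j], which carries the difference of its messages. *)
pose e (ju : 'I_n * 'I_s) := if ju.1 == i then z i (ins b ju.2)
  else if ju.2 == ins b ord0 ju.1 then \sum_v z ju.1 (ins b v) else 0.
suff /(_ (i, u)) : forall ju, e ju = 0 by rewrite /e eqxx.
pose A1 := [set (i, v) | v : 'I_s]%SET.
pose A2 := [set (j, ins b ord0 j) | j in ~: (i |: H)]%SET.
apply: (vandermonde_weight_eq0 (x := lam) (r := r) (A := (A1 :|: A2)%SET)).
- by move=> ju ju' _ _; apply: lam_inj.
- apply: leq_trans (leq_card_setU _ _) _.
  have c1 : (#|A1| <= s)%N by rewrite -[X in (_ <= X)%N]card_ord; apply: leq_imset_card.
  have c2 : (#|A2| <= #|~: (i |: H)%SET|)%N by apply: leq_imset_card.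
  apply: leq_trans (leq_add c1 c2) _.
  have := cardsC (i |: H)%SET; rewrite cardsU1 iH cardH card_ord.
  move: #|(~: (i |: H))%SET| => m; rewrite /r /s; lia.
- move=> [j v]; rewrite inE negb_or /e /= => /andP[jA1 jA2].
  case: eqP => [ji|/eqP ji]; first by rewrite ji imset_f in jA1.
  case: eqP => // vb; have jH : j \in H.
    apply: contraR jA2 => jH; rewrite vb; apply: (imset_f (fun j => (j, ins b ord0 j))).
    by rewrite !inE negb_or ji.
  have /ffunP/(_ b) := E j jH; rewrite !ffunE => Ej.
  by rewrite sumrB Ej subrr.
(* Check [t] on [e] is the sum over [v] of the checks at [ins b v], since for [j] other than [i] the
   point [lam (j, ins b v j)] does not depend on [v]. *)
move=> t; under eq_bigr do rewrite [X in lam X]surjective_pairing [X in e X]surjective_pairing.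
rewrite -(pair_bigA _ (fun j v => lam (j, v) ^+ t * e (j, v))) /=.
transitivity (\sum_j \sum_v lam (j, ins b v j) ^+ t * z j (ins b v)); last first.
  by rewrite exchange_big big1 //= => v _; apply: check.
apply: eq_bigr => j _; rewrite /e /=.
case: eqP => [->|/eqP ji]; first by apply: eq_bigr => v _; rewrite insi.
rewrite (bigD1 (ins b ord0 j)) //= eqxx [X in _ + X = _]big1 => [|v vb]; last first.
  by rewrite (negbTE vb) mulr0.
by rewrite addr0 mulr_sumr; apply: eq_bigr => v _; rewrite insj.
Qed.

(** * Bounds on the two capacities *)

Lemma le_expR_ln (R : realType) (x y : R) : ln x <= y -> x <= expR y.
Proof.
move=> lnx; have [x_gt0|x_le0] := ltP 0 x; last exact: le_trans x_le0 (expR_ge0 _).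
by rewrite -[leLHS](lnK x_gt0) ler_expR.
Qed.

Section Capacity.
Context {R : realType} (n k d : nat) (alpha gamma : R).
Hypotheses (le_kd : (k <= d)%N) (lt_dn : (d < n)%N).

Lemma rate_le_Cfr (F : finType) (A Bt : nat) (W : 'I_n -> F -> 'I_A) (t : R) :
  0 < t -> exact_repair_code k d Bt W ->
  ln (A%:R : R) <= alpha * t -> ln (Bt%:R : R) <= gamma / d%:R * t ->
  ln (#|F|%:R : R) / t <= Cfr k d alpha gamma.
Proof.
move=> t_gt0 HW /le_expR_ln lnA /le_expR_ln lnB; rewrite ler_pdivrMr //.
have Cge : #|F|%:R <= expR (Cfr k d alpha gamma * t).
  apply: (@le_trans _ _ (\prod_(j < k) minn A (Bt ^ (d - j)))%N%:R).
    by rewrite ler_nat; exact: (exact_repair_code_card le_kd lt_dn HW).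
  rewrite /Cfr mulr_suml expR_sum natr_prod; apply: ler_prod => j _.
  rewrite ler0n /=; case: (leP alpha) => _.
    by apply: le_trans lnA; rewrite ler_nat geq_minl.
  apply: (@le_trans _ _ (Bt ^ (d - j))%N%:R); first by rewrite ler_nat geq_minr.
  have -> : (d - j)%:R / d%:R * gamma * t = (d - j)%:R * (gamma / d%:R * t) by ring.
  by rewrite natrX expRM_natl lerXn2r // nnegrE ?ler0n ?expR_ge0.
(* Returning to [ln] requires a file to exist; any value of a decoder is one. *)
have F_gt0 : 0 < #|F|%:R :> R.
  have cardK : #|[set j : 'I_n | (j < k)%N]%SET| = k by apply: card_ord_lt; lia.
  have [Dec _] := HW.1 _ cardK.
  by rewrite ltr0n; apply/card_gt0P; exists (Dec [::]).
by rewrite -ler_expR lnK.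
Qed.

Lemma rate_le_Cexact (F : finType) (A Bt : nat) (W : 'I_n -> F -> 'I_A) (t : R) :
  0 < t -> exact_repair_code k d Bt W ->
  ln (A%:R : R) <= alpha * t -> ln (Bt%:R : R) <= gamma / d%:R * t ->
  ln (#|F|%:R : R) / t <= Cexact n k d alpha gamma.
Proof.
move=> t_gt0 HW lnA lnB; apply: ub_le_sup; last by exists F, A, Bt, W, t.
exists (Cfr k d alpha gamma) => _ [F' [A' [Bt' [W' [t' [t'_gt0 HW' lnA' lnB' ->]]]]]].
exact: rate_le_Cfr t'_gt0 HW' lnA' lnB'.
Qed.

Lemma Cexact_le_Cfr : 0 <= alpha -> 0 <= gamma ->
  Cexact n k d alpha gamma <= Cfr k d alpha gamma.
Proof.
move=> alpha_ge0 gamma_ge0; apply: ge_sup; last first.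
  by move=> _ [F [A [Bt [W [t [t_gt0 HW lnA lnB ->]]]]]]; exact: rate_le_Cfr t_gt0 HW lnA lnB.
(* The one-file code shows that the set of rates is nonempty, as [ge_sup] demands. *)
pose W (i : 'I_n) (f : unit) : unit := tt.
have HW : exact_repair_code k d #|{: unit}| (fun i f => enum_rank (W i f)).
  apply: (@exact_repair_code_of_inj n k d unit unit unit tt W) => [_ [] []//|i H _ _].
  by exists (fun _ _ => tt).
exists (ln #|{: unit}|%:R / 1), unit, #|{: unit}|, #|{: unit}|,
  (fun i f => enum_rank (W i f)), 1; split.
- exact: ltr01.
- exact: HW.
- by rewrite card_unit ln1 mulr1.
- by rewrite card_unit ln1 mulr1 divr_ge0.
- by [].
Qed.

(** An MSR code for [k'] is also a code for [k]; lowering [k'] trades file size for a smaller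
    message, [alpha / (d - k' + 1)]. *)
Lemma Cexact_ge_msr (k' : nat) : 0 < alpha -> (k' <= k)%N ->
  alpha / (d - k').+1%:R <= gamma / d%:R ->
  k'%:R * alpha <= Cexact n k d alpha gamma.
Proof.
move=> alpha_gt0 le_k'k le_gamma.
have [q [F [A [Bt [W [q_gt1 AE BtE cardF HW]]]]]] :=
  msr_code (leq_trans le_k'k le_kd) lt_dn.
set s := (d - k').+1 in le_gamma AE BtE cardF.
have q_gt0 : 0 < q%:R :> R by rewrite ltr0n ltnW.
have lnq : 0 < ln (q%:R : R) by rewrite ln_gt0 // ltr1n.
have l_gt0 : 0 < (s ^ n)%:R :> R by rewrite ltr0n expn_gt0.
(* The unit in which the [s ^ n] letters of a node amount to exactly [alpha]; a message is then the
   fraction [1 / s] of a node. *)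
pose t := (s ^ n)%:R * ln (q%:R : R) / alpha.
have t_gt0 : 0 < t by rewrite divr_gt0 // mulr_gt0.
apply: le_trans (rate_le_Cexact t_gt0 (HW k le_k'k) _ _).
- rewrite ler_pdivlMr //.
  have -> : k'%:R * alpha * t = ln ((q ^ (k' * s ^ n))%:R : R).
    rewrite natrX lnXn // -[ln _ *+ _]mulr_natl natrM /t; field.
    exact: lt0r_neq0.
  rewrite ler_ln ?posrE ?ltr0n ?ler_nat ?expn_gt0 //.
    by rewrite (ltnW q_gt1).
  by apply: leq_trans cardF; rewrite expn_gt0 ltnW.
- rewrite AE natrX lnXn // -[ln _ *+ _]mulr_natl /t mulrCA divff ?mulr1 //.
  exact: lt0r_neq0.
- apply: (@le_trans _ _ (alpha / s%:R * t)); last by rewrite ler_pM2r.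
  have -> : alpha / s%:R * t = (s ^ n.-1)%:R * ln q%:R.
    have sE : (s ^ n = s * s ^ n.-1)%N by rewrite -expnS prednK //; lia.
    by rewrite /t sE natrM; field; rewrite !lt0r_neq0 ?ltr0n.
  by rewrite BtE natrX lnXn // -[ln _ *+ _]mulr_natl.
Qed.

(** When the [d] letters of a node amount to [alpha], the file amounts to the sum of the
    [(d - j) / d * alpha], which dominates [Cfr] at bandwidth [alpha]. *)
Lemma Cexact_ge_mbr : (0 < d)%N -> 0 < alpha -> alpha <= gamma ->
  Cfr k d alpha alpha <= Cexact n k d alpha gamma.
Proof.
move=> d_gt0 alpha_gt0 le_gamma.
have [q [F [A [Bt [W [q_gt1 AE BtE cardF HW]]]]]] := mbr_code n le_kd.
have q_gt0 : 0 < q%:R :> R by rewrite ltr0n ltnW.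
have lnq : 0 < ln (q%:R : R) by rewrite ln_gt0 // ltr1n.
have dR_gt0 : 0 < d%:R :> R by rewrite ltr0n.
pose t := d%:R * ln (q%:R : R) / alpha.
have t_gt0 : 0 < t by rewrite divr_gt0 // mulr_gt0.
apply: le_trans (rate_le_Cexact t_gt0 HW _ _).
- rewrite ler_pdivlMr // cardF natrX lnXn // -[ln _ *+ _]mulr_natl natr_sum.
  have -> : ln (q%:R : R) = alpha / d%:R * t by rewrite /t; field; rewrite !lt0r_neq0.
  rewrite mulrA ler_wpM2r ?(ltW t_gt0) // mulr_suml; apply: ler_sum => j _.
  by rewrite ge_min mulrA [_ / _ * alpha]mulrAC lexx orbT.
- rewrite AE natrX lnXn // -[ln _ *+ _]mulr_natl /t mulrCA divff ?mulr1 //.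
  exact: lt0r_neq0.
- apply: (@le_trans _ _ (alpha / d%:R * t)).
    by rewrite BtE /t le_eqVlt; apply/orP; left; apply/eqP; field; rewrite !lt0r_neq0.
  by rewrite ler_pM2r // ler_pM2r ?invr_gt0.
Qed.

Lemma Cfr_gt0 : (0 < k)%N -> 0 < alpha -> 0 < gamma -> 0 < Cfr k d alpha gamma.
Proof.
move=> k_gt0 alpha_gt0 gamma_gt0.
have min_gt0 (j : 'I_k) : 0 < Num.min alpha ((d - j)%:R / d%:R * gamma).
  have lt_jd := leq_trans (ltn_ord j) le_kd.
  by rewrite lt_min alpha_gt0 mulr_gt0 // divr_gt0 // ltr0n ?subn_gt0 // (leq_trans _ lt_jd).
rewrite /Cfr (bigD1 (Ordinal k_gt0)) //= ltr_pwDl ?(min_gt0 (Ordinal k_gt0)) //.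
by apply: sumr_ge0 => j _; apply: ltW.
Qed.

Lemma Cfr_le : Cfr k d alpha gamma <= k%:R * alpha.
Proof.
rewrite mulr_natl -[k in leRHS]card_ord -sumr_const.
by apply: ler_sum => j _; rewrite ge_min lexx.
Qed.

End Capacity.

(** * The limit of the capacity ratio *)

Theorem theorem5p2 (R : realType) (n k d : nat) (alpha s : R) :
  (1 <= k)%N -> (k <= d)%N -> (d < n)%N -> 0 < alpha -> 0 <= s <= 1 ->
  (     Cexact (n + M) (k + M) (d + M) alpha
        (s * ((d + M)%:R * alpha / ((d + M) - (k + M) + 1)%:R) + (1 - s) * alpha)
     / Cfr (k + M) (d + M) alpha
        (s * ((d + M)%:R * alpha / ((d + M) - (k + M) + 1)%:R) + (1 - s) * alpha))
  @[M --> \oo] --> (1 : R).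
Proof.
move=> k_gt0 le_kd lt_dn alpha_gt0 /andP[s_ge0 s_le1].
have le_kdM M : (k + M <= d + M)%N by rewrite leq_add2r.
have lt_dnM M : (d + M < n + M)%N by rewrite ltn_add2r.
have kM_gt0 M : (0 < k + M)%N by rewrite addn_gt0 k_gt0.
have dM_gt0 M : (0 < d + M)%N by apply: leq_trans (kM_gt0 M) (le_kdM M).
move: s_ge0; rewrite le_eqVlt => /predU1P[<-|s_gt0].
  apply: cvg_near_cst; apply: nearW => M.
  rewrite mul0r add0r subr0 mul1r; apply/eqP.
  rewrite -(divff (lt0r_neq0 (Cfr_gt0 (le_kdM M) (kM_gt0 M) alpha_gt0 alpha_gt0))).
  apply/eqP; congr (_ / _); apply/le_anti/andP; split.
    by apply: Cexact_le_Cfr => //; apply: ltW.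
  exact: Cexact_ge_mbr.
pose gamma M : R := s * ((d + M)%:R * alpha / ((d + M) - (k + M) + 1)%:R) + (1 - s) * alpha.
have gamma_gt0 M : 0 < gamma M.
  rewrite ltr_pwDl // ?mulr_ge0 ?subr_ge0 ?(ltW alpha_gt0) //.
  by rewrite mulr_gt0 // divr_gt0 ?mulr_gt0 ?ltr0n // addn1.
have C_gt0 M : 0 < Cfr (k + M) (d + M) alpha (gamma M) by apply: Cfr_gt0.
(* Lowering the data collection degree by [c] brings the MSR repair bandwidth
   below [gamma M], at a relative cost [c / (k + M)] in file size. *)
pose c := Num.bound ((d - k).+1%:R / s).
have cP : (d - k).+1%:R / s < c%:R by apply: archi_boundP; rewrite divr_ge0 // ltW.
(* [harmonic m] is [1 / (m + 1)], so the index [M + k.-1] yields [1 / (k + M)]. *)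
apply: (@squeeze_cvgr _ _ _ _ (fun M => 1 - c%:R * harmonic (M + k.-1)%N) (cst 1)).
- near=> M; have le_cM : (c <= M)%N by near: M; apply: nbhs_infty_ge.
  rewrite -/(gamma M) /cst; apply/andP; split; last first.
    by rewrite ler_pdivrMr // mul1r Cexact_le_Cfr // ltW.
  have -> : harmonic (M + k.-1)%N = (k + M)%:R^-1 :> R.
    by rewrite /harmonic /= -addnS prednK // addnC.
  have kR_gt0 : 0 < (k + M)%:R :> R by rewrite ltr0n.
  rewrite ler_pdivlMr //.
  apply: (@le_trans _ _ ((k + M - c)%:R * alpha)).
    rewrite natrB; last by rewrite (leq_trans le_cM) // leq_addl.
    apply: (@le_trans _ _ ((1 - c%:R / (k + M)%:R) * ((k + M)%:R * alpha))).
      rewrite ler_wpM2l ?Cfr_le // subr_ge0 ler_pdivrMr // mul1r ler_nat.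
      by rewrite (leq_trans le_cM) // leq_addl.
    by rewrite mulrA mulrBl mul1r divfK // lt0r_neq0.
  apply: Cexact_ge_msr => //; first exact: leq_subr.
  have -> : (d + M - (k + M - c) = d - k + c)%N by lia.
  rewrite /gamma subnDr addn1.
  have dR_gt0 : 0 < (d + M)%:R :> R by rewrite ltr0n.
  (* The MSR share of [gamma M] suffices: per helper it is [s * alpha / (d - k + 1)], and the choice
     of [c] puts [alpha / (d - k + c + 1)] below it. *)
  apply: (@le_trans _ _ (s * alpha / (d - k).+1%:R)); last first.
    have -> : s * alpha / (d - k).+1%:R = s * ((d + M)%:R * alpha / (d - k).+1%:R) / (d + M)%:R.
      by rewrite [RHS]mulrC -[(d + M)%:R * _ / _]mulrA [s * (_ * _)]mulrCA mulKf ?mulrA ?lt0r_neq0.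
    by rewrite mulrDl lerDl divr_ge0 ?mulr_ge0 ?subr_ge0 // ltW.
  rewrite ler_pdivrMr ?ltr0n // mulrAC ler_pdivlMr ?ltr0n //.
  rewrite [s * alpha]mulrC -mulrA ler_pM2l // [s * _]mulrC -ler_pdivrMr //.
  apply: le_trans (ltW cP) _.
  by rewrite ler_nat; lia.
- rewrite -[X in _ --> X]subr0; apply: cvgB; first exact: cvg_cst.
  rewrite -[X in _ --> X](mulr0 c%:R); apply: cvgMr.
  by have := @cvg_harmonic R; rewrite -(cvg_shiftn k.-1).
- exact: cvg_cst.
Unshelve. all: by end_near.
Qed.
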